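(* Let $p\ge2$ be an integer, $\epsilon>0$, $N>1$ and $0<C\le\dfrac{(N^2-1)^{\frac{p-2}2}}{(2N)^{p-1}p^p}$. Let $f\colon\mathbb{R}^d\to\mathbb{R}$ be a convex function with unique minimizer $x^*$ that is $\frac{(p-1)!}\epsilon$-smooth of order $p-1$, and let $h\colon\mathbb{R}^d\to\mathbb{R}$ be a distance-generating function that is $1$-uniformly convex of order $p$. Let $(x_k)_{k\ge0}$, $(y_k)_{k\ge0}$, $(z_k)_{k\ge0}$ be generated from $z_0=x_0\in\mathbb{R}^d$ by $$x_{k+1}=\frac p{k+p}z_k+\frac k{k+p}y_k\quad(k\ge0),$$ $$y_k=\arg\min_{y\in\mathbb{R}^d}\Big\{f_{p-1}(y;x_k)+\frac N{\epsilon p}\|y-x_k\|^p\Big\}\quad(k\ge0),$$ $$z_k=\arg\min_{z\in\mathbb{R}^d}\Big\{Cp\,k^{(p-1)}\langle\nabla f(y_k),z\rangle+\frac1\epsilon D_h(z,z_{k-1})\Big\}\quad(k\ge1).$$ Then the algorithm has an $O(1/(\epsilon k^p))$ convergence rate: there is a constant $K\ge0$, depending only on $p$, $C$ and $D_h(x^*,x_0)$ (in particular not on $k$ or $\epsilon$), such that $f(y_k)-f(x^* )\le\dfrac{K}{\epsilon k^p}$ for all $k\ge1$.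
   Context: $\|\cdot\|$ is the inner product norm $\|x\|=\langle x,x\rangle^{1/2}$ on $\mathbb{R}^d$ and $\|\cdot\|_*$ is its dual norm (for multilinear forms, the induced operator norm). A distance-generating function $h$ is convex and essentially smooth ($h$ is continuously differentiable and $\|\nabla h(x)\|_*\to\infty$ as $\|x\|\to\infty$). Its Bregman divergence is $D_h(y,x)=h(y)-h(x)-\langle\nabla h(x),y-x\rangle$. $h$ is $\sigma$-uniformly convex of order $p$ if $D_h(y,x)\ge\frac\sigma p\|y-x\|^p$ for all $x,y$. $f$ is $L$-smooth of order $p-1$ if $f$ is $p$-times continuously differentiable and $\|\nabla^{p-1}f(y)-\nabla^{p-1}f(x)\|_*\le L\|y-x\|$ for all $x,y$. The Taylor approximation is $f_{p-1}(y;x)=\sum_{i=0}^{p-1}\frac1{i!}\nabla^if(x)(y-x)^i$. An equation $y=\arg\min\{\cdots\}$ means that $y$ is a global minimizer. $k^{(q)}=k(k+1)\cdots(k+q-1)$ denotes the rising factorial. *)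

(* Defs.v *)
From HB Require Import structures.
From mathcomp Require Import all_boot all_order all_algebra.
From mathcomp Require Import sesquilinear.
From mathcomp Require Import all_classical all_reals all_analysis.

Set Implicit Arguments.
Unset Strict Implicit.
Unset Printing Implicit Defensive.

Import Order.TTheory GRing.Theory Num.Theory.
Import numFieldNormedType.Exports.
Local Open Scope classical_set_scope.
Local Open Scope ring_scope.

Definition is_argmin (T : Type) (R : realType) (g : T -> R) (y : T) : Prop :=
  forall z, g y <= g z.

(* k^{(q)} = k (k+1) ... (k+q-1); MathComp only has the falling factorial. *)
Definition rising (k q : nat) : nat := \prod_(i < q) (k + i)%N.

Section Smoothness.
Context {R : realType} {d : nat}.
Local Notation V := 'rV[R]_d.

(* R^d carries an arbitrary inner product.  The norm [`| |] that the library
   puts on 'rV[R]_d is the sup norm; it only supplies the topology (hence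
   differentiability and continuity), which does not depend on the norm. *)
Variable dot : {dot V for idfun}.

Definition inorm (x : V) : R := Num.sqrt (dot x x).

(* The multilinear form (nabla^i f)(x), evaluated at the list vs of its i
   arguments.  In particular [nabla f [:: v] x] is the pairing
   < nabla f(x), v >. *)
Fixpoint nabla (f : V -> R) (vs : seq V) : V -> R :=
  if vs is v :: vs' then fun x => 'd (nabla f vs') x v else f.

(* n times continuously differentiable.  In finite dimension the map
   x |-> Df(x) is C^n iff x |-> Df(x)(v) is C^n for every vector v. *)
Fixpoint Cn (n : nat) (f : V -> R) : Prop :=
  if n is n'.+1 then
    (forall x, differentiable f x) /\ (forall v, Cn n' (fun x => 'd f x v))
  else continuous f.

(* The value is an extended real so that the supremum of an unbounded set is
   +oo and not a default value. *)
Definition dual_norm (i : nat) (A : i.-tuple V -> R) : \bar R :=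
  ereal_sup [set `|A v|%:E | v in
    [set v : i.-tuple V | forall j, inorm (tnth v j) <= 1]].

(* L-smooth of order q, where q = p - 1. *)
Definition smooth_of_order (L : R) (q : nat) (f : V -> R) : Prop :=
  Cn q.+1 f /\
  forall x y : V,
    (dual_norm (fun v : q.-tuple V => (nabla f v y - nabla f v x)%R)
       <= (L * inorm (y - x)%R)%:E)%E.

Definition taylor (f : V -> R) (q : nat) (x y : V) : R :=
  \sum_(i < q.+1) (i`!%:R)^-1 * nabla f (nseq i (y - x)) x.

Definition bregman (h : V -> R) (y x : V) : R :=
  h y - h x - nabla h [:: y - x] x.

Definition convex (f : V -> R) : Prop := convex_function (E := V) setT f.

Definition essentially_smooth (h : V -> R) : Prop :=
  Cn 1 h /\
  forall M : R, exists r : R, forall x : V, r <= inorm x ->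
    (M%:E <= dual_norm (fun v : 1.-tuple V => nabla h v x))%E.

Definition distance_generating (h : V -> R) : Prop :=
  convex h /\ essentially_smooth h.

Definition uniformly_convex (sigma : R) (p : nat) (h : V -> R) : Prop :=
  forall x y : V, sigma / p%:R * inorm (y - x) ^+ p <= bregman h y x.

End Smoothness.

(* Main.v *)
(** A Lyapunov argument: with
      [E_k = C k^{(p)} (f(y_k) - f( x* )) + D_h( x*, z_k) / eps]
    one has [E_0 = D_h( x*, x_0) / eps], so it is enough that [E] is
    nonincreasing.  Convexity of [f] and the optimality condition of the mirror
    step reduce [E_{k+1} <= E_k] to
      [C p a <g, z_k - z_{k+1}>
         <= |z_{k+1} - z_k|^p / (eps p) + C b <g, x_{k+1} - y_{k+1}>]
    where [g] is the gradient of [f] at [y_{k+1}], [a = (k+1)^{(p-1)}] and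
    [b = (k+1)^{(p)}].  By Taylor's formula and the optimality condition of the
    proximal step, [g] is within [r^{p-1} / eps] of
    [- (N / eps) r^{p-2} (y_{k+1} - x_{k+1})], where [r = |y_{k+1} - x_{k+1}|];
    expanding the square of the distance bounds
    [<g, x_{k+1} - y_{k+1}>] from below by a multiple of [|g|^{p/(p-1)}], and
    Young's inequality concludes. *)

Require Import Defs.
From HB Require Import structures.
From mathcomp Require Import all_boot all_order all_algebra.
From mathcomp Require Import sesquilinear.
From mathcomp Require Import all_classical all_reals all_analysis.
From mathcomp Require Import ring lra.
Set Implicit Arguments.
Unset Strict Implicit.
Unset Printing Implicit Defensive.
Import Order.TTheory GRing.Theory Num.Theory.
Import numFieldNormedType.Exports.
Local Open Scope ring_scope.

(** * One-variable calculus *)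

Section OneVariable.
Local Open Scope classical_set_scope.
Context {R : realType}.

Lemma scaleRE (a b : R) : a *: b = a * b.
Proof. by []. Qed.

(** If [c] were negative, all difference quotients at small steps would be negative. One good [s]
    below each [e] contradicts this, so one-sided information suffices, as [convex_gradient]
    needs. *)
Lemma is_derive_ge0 (g : R -> R) (t c : R) : is_derive t (1 : R) g c ->
  (forall e : R, 0 < e -> exists2 s : R, 0 < s < e & g t <= g (t + s)) -> 0 <= c.
Proof.
case=> dg <- H; rewrite leNgt; apply/negP => c0.
have : (fun h : R => h^-1 *: (g (h *: (1:R) + t) - g t)) @ 0^' --> 'D_1 g t by [].
move=> /cvgrPdist_lt /(_ (- 'D_1 g t)).
rewrite oppr_gt0 => /(_ c0) [e /= e0 He].
have [s /andP[s0 se] gs] := H _ e0.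
have : `|'D_1 g t - s^-1 * (g (t + s) - g t)| < - 'D_1 g t.
  have := He s; rewrite /= sub0r normrN gtr0_norm// => /(_ se (lt0r_neq0 s0)).
  by rewrite [s *: 1]mulr1 (addrC s).
have : 0 <= s^-1 * (g (t + s) - g t).
  by apply: mulr_ge0; [rewrite invr_ge0 ltW|rewrite subr_ge0].
by rewrite ltr_norml => + /andP[+ _]; lra.
Qed.

Lemma is_derive_min (g : R -> R) (t c : R) : is_derive t (1 : R) g c ->
  (forall s, g t <= g s) -> c = 0.
Proof.
move=> dg H; apply/eqP; rewrite eq_le; apply/andP; split; last first.
  by apply: (is_derive_ge0 dg) => e e0; exists (e / 2); rewrite ?H//; lra.
rewrite -oppr_ge0.
have dgN : is_derive (- t) (1 : R) (g \o -%R) (c * -1).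
  by apply: is_derive1_comp; rewrite opprK.
rewrite -mulrN1; apply: (is_derive_ge0 dgN) => e e0.
by exists (e / 2); rewrite /= ?opprK ?H//; lra.
Qed.

Lemma le_of_derive_le (f g df dg : R -> R) (r : R) : 0 <= r ->
  (forall t, is_derive t (1 : R) f (df t)) ->
  (forall t, is_derive t (1 : R) g (dg t)) ->
  (forall t, 0 <= t <= r -> df t <= dg t) -> f 0 <= g 0 -> f r <= g r.
Proof.
move=> r0 Df Dg le fg0.
have D t : is_derive t (1 : R) (g - f) (dg t - df t).
  exact: is_deriveB.
have [c] := @MVT_segment R (g - f) (fun t => dg t - df t) 0 r r0 (fun t _ => D t)
  (derivable_within_continuous (fun t _ => (@ex_derive _ _ _ _ _ _ _ (D t)))).
rewrite in_itv/= => /le le'; rewrite subr0 !fctE => E.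
have : 0 <= (dg c - df c) * r by rewrite mulr_ge0// subr_ge0.
by rewrite -E; lra.
Qed.

(** The sequence [phi] lists successive derivatives, and the last one is only compared with its
    value at 0, so no derivative of order [q + 1] is needed. Induction on [q]: the shifted sequence
    bounds the derivative of the remainder, and integrating gives the bound for the remainder
    itself. *)
Lemma taylor_remainder_le (phi : nat -> R -> R) (q : nat) (M r : R) : 0 <= r ->
  (forall i t, (i < q)%N -> is_derive t (1 : R) (phi i) (phi i.+1 t)) ->
  (forall t, 0 <= t <= r -> `|phi q t - phi q 0| <= M * t) ->
  `|phi 0%N r - \sum_(i < q.+1) (i`!%:R)^-1 * phi i 0 * r ^+ i|
     <= M * r ^+ q.+1 / (q.+1)`!%:R.
Proof.
elim: q phi r => [|q IH] phi r r0 dphi phiq.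
  rewrite big_ord1 fact0 factS mul1n fact0 invr1 !mul1r !expr0 !mulr1 expr1.
  by rewrite phiq// lexx r0.
pose P t := \sum_(i < q.+2) (i`!%:R)^-1 * phi i 0 * t ^+ i.
pose dP t := \sum_(i < q.+1) (i`!%:R)^-1 * phi i.+1 0 * t ^+ i.
have DP t : is_derive t (1 : R) P (dP t).
  have -> : P = \sum_(i < q.+2) ((i`!%:R)^-1 * phi i 0) \*: (@id R ^+ i).
    by apply/funext => s; rewrite fct_sumE; apply: eq_bigr => i _; rewrite fctE.
  apply: is_derive_eq; rewrite big_ord_recl /= mul0r !scale0r scaler0 add0r.
  apply: eq_bigr => i _; rewrite /bump /= add1n factS natrM.
  have i0 : i.+1%:R != 0 :> R by rewrite pnatr_eq0.
  have f0 : i`!%:R != 0 :> R by rewrite pnatr_eq0 -lt0n fact_gt0.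
  rewrite !scaleRE add0n mulr1; by field; rewrite f0 nat1r.
pose B t := M * t ^+ q.+2 / (q.+2)`!%:R.
pose dB t := M * t ^+ q.+1 / (q.+1)`!%:R.
have DB t : is_derive t (1 : R) B (dB t).
  have -> : B = (M / (q.+2)`!%:R) \*: (@id R ^+ q.+2).
    by apply/funext => s; rewrite fctE /= /B mulrAC.
  apply: is_derive_eq; rewrite !scaleRE mulr1 /= /dB factS natrM.
  have i0 : q.+2%:R != 0 :> R by rewrite pnatr_eq0.
  have f0 : (q.+1)`!%:R != 0 :> R by rewrite pnatr_eq0 -lt0n fact_gt0.
  by field; rewrite f0 -(natrD _ 2).
have D0 t : is_derive t (1 : R) (phi 0%N) (phi 1%N t) by apply: dphi.
have le t : 0 <= t <= r -> `|phi 1%N t - dP t| <= dB t.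
  move=> /andP[t0 tr]; apply: (IH (fun i => phi i.+1)) => // [i s iq|s /andP[s0 st]].
    exact: dphi.
  by apply: phiq; rewrite s0 (le_trans st).
have P0 : P 0 = phi 0%N 0.
  rewrite /P big_ord_recl expr0 fact0 invr1 mul1r mulr1 big1 ?addr0// => i _.
  by rewrite expr0n /= mulr0.
have B0 : B 0 = 0 by rewrite /B expr0n /= mulr0 mul0r.
(* [phi 0] lies between [P - B] and [P + B]: all three agree at 0, and [le] compares their
   derivatives. *)
rewrite ler_norml; apply/andP; split.
  have : (P - B) r <= phi 0%N r.
    apply: (@le_of_derive_le _ _ (dP - dB) (phi 1%N)) => //.
      by move=> t /le; rewrite ler_norml => /andP[+ _]; rewrite !fctE; lra.
    by rewrite !fctE P0 B0 subr0.
  by rewrite !fctE /B -/(P r); lra.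
have : phi 0%N r <= (P + B) r.
  apply: (@le_of_derive_le _ _ (phi 1%N) (dP + dB)) => //.
    by move=> t /le; rewrite ler_norml => /andP[_]; rewrite !fctE; lra.
  by rewrite !fctE P0 B0 addr0.
by rewrite !fctE /B -/(P r); lra.
Qed.

End OneVariable.

(** * Symmetry of iterated derivatives *)

Section Iterated.
Local Open Scope classical_set_scope.
Context {R : realType} {d : nat}.
Local Notation V := 'rV[R]_d.
Implicit Types (f : V -> R) (u v w x : V) (us vs : seq V).

Lemma is_derive_line f x v t : differentiable f (x + t *: v) ->
  is_derive t (1 : R) (fun s => f (x + s *: v)) ('d f (x + t *: v) v).
Proof.
move=> df; have dg : is_diff t (fun s : R => x + s *: v) (fun s => s *: v).
  have -> : (fun s : R => x + s *: v) = cst x + (fun s => s *: v) by [].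
  have dD := is_diffD (is_diff_cst x t) (is_diff_scalel t v).
  by apply: is_diff_eq; rewrite add0r.
have dfg : differentiable (f \o (fun s : R => x + s *: v)) t.
  by apply: differentiable_comp => //; exact: ex_diff.
apply: DeriveDef; first exact/derivable1_diffP.
by rewrite deriveE// diff_comp//= diff_val scale1r.
Qed.

(* Apply the mean value theorem once along u and once along v. *)
Lemma second_difference f u v x (s : R) : 0 < s ->
  (forall x, differentiable f x) ->
  (forall x, differentiable (fun x => 'd f x u) x) ->
  exists a b, [/\ 0 <= a <= s, 0 <= b <= s &
    f (x + s *: u + s *: v) - f (x + s *: u) - f (x + s *: v) + f x
    = 'd (fun x => 'd f x u) (x + a *: u + b *: v) v * s * s].
Proof.
move=> s0 df ddf.
pose k := (fun t : R => f (x + s *: v + t *: u)) - (fun t : R => f (x + t *: u)).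
pose dk t := 'd f (x + s *: v + t *: u) u - 'd f (x + t *: u) u.
have Dk t : is_derive t (1 : R) k (dk t).
  by apply: is_deriveB; apply: is_derive_line.
have [a] := @MVT_segment R k dk 0 s (ltW s0) (fun t _ => Dk t)
  (derivable_within_continuous (fun t _ => (@ex_derive _ _ _ _ _ _ _ (Dk t)))).
rewrite in_itv/= => ai Ek.
pose l := (fun t : R => 'd f (x + a *: u + t *: v) u).
pose dl t := 'd (fun x => 'd f x u) (x + a *: u + t *: v) v.
have Dl t : is_derive t (1 : R) l (dl t).
  exact: (@is_derive_line (fun x => 'd f x u)).
have [b] := @MVT_segment R l dl 0 s (ltW s0) (fun t _ => Dl t)
  (derivable_within_continuous (fun t _ => (@ex_derive _ _ _ _ _ _ _ (Dl t)))).
rewrite in_itv/= => bi El.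
exists a, b; split=> //; rewrite -/(dl b).
move: El Ek; rewrite !subr0 /l /k !fctE /dk !scale0r !addr0.
rewrite [x + s *: v + a *: u]addrAC => -> <-.
rewrite [x + s *: v + s *: u]addrAC; ring.
Qed.

(** The mean value theorem gives different intermediate points for the two orders of
    differentiation, so [A] and [B] are compared at distinct points [y] and [z], which continuity
    then lets tend to [x]. *)
Lemma eq_lim_of_coincidences (A B : V -> R) x :
  {for x, continuous A} -> {for x, continuous B} ->
  (forall r : R, 0 < r -> exists y z,
    [/\ `|x - y| < r, `|x - z| < r & A y = B z]) -> A x = B x.
Proof.
move=> cA cB H; apply/eqP; rewrite -subr_eq0 -normr_le0.
apply/ler_addgt0Pl => e e0; rewrite addr0.
have e20 : 0 < e / 2 by rewrite divr_gt0.
have [r1 /= r10 H1] := (nbhs_normP _ _).1 ((cvgrPdist_lt _ _).1 cA _ e20).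
have [r2 /= r20 H2] := (nbhs_normP _ _).1 ((cvgrPdist_lt _ _).1 cB _ e20).
have r0 : 0 < Num.min r1 r2 by rewrite lt_min r10.
have [y [z []]] := H _ r0; rewrite !lt_min => /andP[/H1 Ay _] /andP[_ /H2 Bz] E.
rewrite -[A x](subrK (A y)) E -addrA; apply: le_trans (ler_normD _ _) _.
by rewrite [e]splitr lerD// ltW//; [rewrite -E|rewrite distrC].
Qed.

Lemma schwarz f u v x : Cn 2 f ->
  'd (fun x => 'd f x u) x v = 'd (fun x => 'd f x v) x u.
Proof.
move=> [df ddf]; have [du cu] := ddf u; have [dv cv] := ddf v.
apply: (@eq_lim_of_coincidences (fun x => 'd (fun x => 'd f x u) x v)
  (fun x => 'd (fun x => 'd f x v) x u) x (cu v x) (cv u x)) => r r0.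
have n0 : 0 < `|u| + `|v| + 1 by rewrite ltr_wpDl// addr_ge0.
(* With [a, b <= s] the displacement [a u + b v] has norm at most [r / 2]; the summand 1 keeps the
   denominator positive when [u] and [v] vanish. *)
pose s := r / (2 * (`|u| + `|v| + 1)).
have s0 : 0 < s by rewrite divr_gt0// mulr_gt0.
have small (a b : R) : 0 <= a <= s -> 0 <= b <= s ->
    `|x - (x + a *: u + b *: v)| < r.
  move=> /andP[a0 ai] /andP[b0 bi].
  rewrite -addrA opprD addrA subrr sub0r normrN.
  apply: le_lt_trans (ler_normD _ _) _; rewrite !normrZ !ger0_norm//.
  apply: (@le_lt_trans _ _ (s * (`|u| + `|v| + 1))).
    by rewrite !mulrDr mulr1 ler_wpDr ?(ltW s0)// lerD// ler_wpM2r.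
  rewrite /s; set n := _ + 1 in n0 *.
  have -> : r / (2 * n) * n = r / 2 by field; rewrite gt_eqF.
  by rewrite ltr_pdivrMr// ltr_pMr// ltr1n.
have [a [b [ai bi E1]]] := @second_difference f u v x s s0 df du.
have [b' [a' [bi' ai' E2]]] := @second_difference f v u x s s0 df dv.
exists (x + a *: u + b *: v), (x + b' *: v + a' *: u); split.
- exact: small.
- by rewrite addrAC; exact: small.
(* Times [s^2], both sides equal the same second difference, which is symmetric in [u] and [v]. *)
apply: (@mulIf _ (s * s)); first by rewrite mulf_neq0// gt_eqF.
rewrite [LHS]mulrA [RHS]mulrA; apply: (etrans (esym E1)); apply: (etrans _ E2).
by rewrite [x + s *: v + s *: u]addrAC; ring.
Qed.

Lemma Cn_le m n f : (m <= n)%N -> Cn n f -> Cn m f.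
Proof.
elim: n m f => [|n IH] [|m] f //=; last first.
  by rewrite ltnS => mn [df cf]; split => // v; apply: IH.
by move=> _ [df _] x; apply: differentiable_continuous.
Qed.

Lemma Cn_nabla n f vs : Cn n f -> (size vs <= n)%N -> Cn (n - size vs) (nabla f vs).
Proof.
move=> cf; elim: vs => [|v vs IH] /= le; first by rewrite subn0.
by have := IH (ltnW le); rewrite -subSS subSn// => -[_ /(_ v)].
Qed.

Lemma differentiable_nabla n f vs x : Cn n f -> (size vs < n)%N ->
  differentiable (nabla f vs) x.
Proof.
by move=> cf le; have := Cn_nabla cf (ltnW le); rewrite -subSS subSn// => -[].
Qed.

Lemma nabla_swap n f us u v x : Cn n f -> (size us + 2 <= n)%N ->
  nabla f (u :: v :: us) x = nabla f (v :: u :: us) x.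
Proof.
move=> cf le; apply: schwarz.
have := Cn_nabla cf (leq_trans (leq_addr 2 _) le).
by apply: Cn_le; rewrite leq_subRL// (leq_trans (leq_addr 2 _) le).
Qed.

Lemma nabla_move n f us vs u : Cn n f -> (size us + size vs < n)%N ->
  nabla f (us ++ u :: vs) = nabla f (u :: us ++ vs).
Proof.
move=> cf; elim: us => // v us IH /= le; apply/funext => x.
rewrite IH ?(ltnW le)//; apply: (nabla_swap _ _ _ cf).
by rewrite size_cat addn2 -addSn.
Qed.

(** Induction on [us]: its head occurs somewhere in [vs] and is brought to the front by
    [nabla_move], that is, by repeated use of [schwarz]. *)
Lemma nabla_perm n f us vs : Cn n f -> (size us <= n)%N -> perm_eq us vs ->
  nabla f us = nabla f vs.
Proof.
move=> cf; elim: us vs => [|u us IH] vs /= le.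
  by move=> /perm_size/esym/size0nil ->.
move=> puv; have uvs : u \in vs by rewrite -(perm_mem puv) mem_head.
have sv := perm_size puv; case/splitPr: uvs puv sv => a b.
rewrite -(cat1s u b) perm_sym perm_catCA perm_cons perm_sym.
rewrite /= size_cat /= addnS => puv [sv].
have le' : (size a + size b < n)%N by rewrite -sv.
by rewrite (nabla_move _ cf le') /= (IH _ (ltnW le) puv).
Qed.
End Iterated.

(** * Gradient of the Taylor polynomial *)

Section TaylorGradient.
Context {R : realType} {d : nat}.
Local Notation V := 'rV[R]_d.
Implicit Types (f : V -> R) (u v w x : V) (us vs : seq V).

Lemma nabla_cons_linear f vs x (a : R) u v :
  nabla f ((a *: u + v) :: vs) x = a * nabla f (u :: vs) x + nabla f (v :: vs) x.
Proof. by rewrite /= linearP. Qed.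

Lemma nabla_consZ f vs x (a : R) u :
  nabla f ((a *: u) :: vs) x = a * nabla f (u :: vs) x.
Proof. by rewrite /= linearZ. Qed.

Lemma perm_nseqS (T : eqType) j (u : T) (us : seq T) :
  perm_eq (nseq j.+1 u ++ us) (nseq j u ++ u :: us).
Proof. by rewrite -[u :: us]cat1s perm_sym perm_catCA. Qed.

(** Only the head argument of [nabla] is linear by construction; symmetry brings each copy of [a u]
    to the head. The suffix [us] collects the copies already treated. *)
Lemma nabla_nseqZ n f j (a : R) u us x : Cn n f -> (j + size us <= n)%N ->
  nabla f (nseq j (a *: u) ++ us) x = a ^+ j * nabla f (nseq j u ++ us) x.
Proof.
move=> cf; elim: j us => [|j IH] us; first by rewrite expr0 mul1r.
rewrite addSnnS => le.
rewrite (nabla_perm cf _ (perm_nseqS _ _ _)); last first.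
  by rewrite size_cat size_nseq addSnnS.
have le' : (size (nseq j u) + size us < n)%N by rewrite size_nseq -addnS.
by rewrite IH// (nabla_move _ cf le') nabla_consZ mulrA -exprSr.
Qed.

(** Product rule for a symmetric form on the diagonal. One copy of [u + s v] is split by linearity
    into [u] and [s v], both of which join the suffix [us], and the induction hypothesis handles the
    remaining copies. *)
Lemma is_derive_nabla_nseq n f i u v us x : Cn n f -> (i + size us <= n)%N ->
  is_derive (0 : R) (1 : R) (fun s => nabla f (nseq i (u + s *: v) ++ us) x)
    (i%:R * nabla f (nseq i.-1 u ++ v :: us) x).
Proof.
move=> cf; elim: i us => [|i IH] us.
  by move=> _; rewrite mul0r; exact: is_derive_cst.
rewrite addSnnS => le.
pose B us s := nabla f (nseq i (u + s *: v) ++ us) x.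
have -> : (fun s => nabla f (nseq i.+1 (u + s *: v) ++ us) x) =
    B (u :: us) + (@id R) * B (v :: us).
  apply/funext => s; rewrite !fctE /B.
    have le' : (size (nseq i (u + s *: v)%R) + size us < n)%N.
      by rewrite size_nseq -addnS.
    rewrite !(nabla_move _ cf le').
    rewrite -[LHS]/(nabla f ((u + s *: v) :: nseq i (u + s *: v) ++ us) x).
    by move: (nseq i _) => t; rewrite (addrC u) nabla_cons_linear addrC.
have Du : is_derive (0 : R) (1 : R) (B (u :: us)) _ := IH (u :: us) le.
have Dv : is_derive (0 : R) (1 : R) (B (v :: us)) _ := IH (v :: us) le.
have D := is_deriveD Du (is_deriveM (is_derive_id _ _) Dv).
apply: (is_derive_eq D); rewrite !scaleRE mul0r add0r mulr1 /B scale0r addr0.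
rewrite /= -natr1 mulrDl mul1r; congr (_ + _).
(* For [i = 0] the predecessor is truncated, but its coefficient is 0. *)
case: i {IH B Du Dv D} le => [|i] le; first by rewrite !mul0r.
congr (_ * _); rewrite (nabla_perm cf (vs := nseq i.+1 u ++ v :: us))//.
  by rewrite size_cat size_nseq /= addnS -addSn (leq_trans _ le)// !addSn !addnS.
rewrite perm_sym; apply: (perm_trans (perm_nseqS _ _ _)).
by rewrite perm_cat2l; apply/permPl; exact: (perm_catCA [:: u] [:: v] us).
Qed.

(** This sum plays two roles: it is the derivative in direction [v] of the Taylor polynomial of [f]
    of degree [q], and it is the Taylor polynomial of degree [q - 1] of the map sending a point to
    the derivative of [f] there along [v]. The first serves the proximal optimality condition, the
    second the remainder estimate. *)
Definition dtaylor f (q : nat) x w v : R :=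
  \sum_(i < q) (i`!%:R)^-1 * nabla f (v :: nseq i w) x.

Lemma is_derive_taylor n f q x y v : Cn n f -> (q <= n)%N ->
  is_derive (0 : R) (1 : R) (fun s => taylor f q x (y + s *: v))
    (dtaylor f q x (y - x) v).
Proof.
move=> cf qn.
pose D i := i%:R * nabla f (nseq i.-1 (y - x) ++ [:: v]) x.
pose F i s := nabla f (nseq i (y - x + s *: v) ++ [::]) x.
have DF (i : 'I_q.+1) : is_derive (0 : R) (1 : R) (F i) (D i).
  apply: is_derive_nabla_nseq cf _; rewrite addn0 (leq_trans _ qn)//.
  by rewrite -ltnS.
have -> : (fun s => taylor f q x (y + s *: v)) =
    \sum_(i < q.+1) (i`!%:R)^-1 \*: F i.
  apply/funext => s; rewrite fct_sumE; apply: eq_bigr => i _.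
  by rewrite /F /= cats0 (addrAC y).
apply: is_derive_eq; rewrite big_ord_recl /D /= mul0r scaler0 add0r.
apply: eq_bigr => i _; rewrite scaleRE /bump /= add1n add0n factS natrM cats1.
rewrite invfM -mulrA mulrCA mulKf ?pnatr_eq0// -cats1 (nabla_move _ cf) ?cats0//.
by rewrite size_nseq addn0 (leq_trans (ltn_ord i)).
Qed.

End TaylorGradient.

(** * The inner product norm, its powers, and the Taylor remainder of the gradient *)

Section InnerNorm.
Local Open Scope classical_set_scope.
Context {R : realType} {d : nat}.
Local Notation V := 'rV[R]_d.
Variable dot : {dot V for idfun}.
Implicit Types (f : V -> R) (u v w x : V) (us vs : seq V).

Lemma dotC u v : dot u v = dot v u.
Proof. by rewrite hermC /= expr0 mul1r. Qed.

Lemma dotPl (a : R) u v w : dot (a *: u + v) w = a * dot u w + dot v w.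
Proof. by rewrite linearDl linearZl_LR. Qed.

Lemma dotPr (a : R) u v w : dot w (a *: u + v) = a * dot w u + dot w v.
Proof. by rewrite linearDr linearZr_LR. Qed.

Lemma dot_ge0 u : 0 <= dot u u.
Proof.
have [->|u0] := eqVneq u 0; first by rewrite linear0l.
by rewrite ltW// neq0_dnorm_gt0.
Qed.

Lemma inorm_ge0 u : 0 <= inorm dot u. Proof. exact: sqrtr_ge0. Qed.

Lemma inorm_sqr u : inorm dot u ^+ 2 = dot u u.
Proof. by rewrite sqr_sqrtr ?dot_ge0. Qed.

Lemma inorm0_eq0 u : inorm dot u = 0 -> u = 0.
Proof.
move=> u0; apply/eqP/contraT => /(neq0_dnorm_gt0 (s := dot)).
by rewrite -inorm_sqr u0 expr0n ltxx.
Qed.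

Lemma inorm0 : inorm dot 0 = 0.
Proof. by rewrite /inorm linear0l sqrtr0. Qed.

Lemma inormZ (a : R) u : inorm dot (a *: u) = `|a| * inorm dot u.
Proof.
rewrite /inorm linearZl_LR /= linearZr_LR /= mulrA -expr2.
by rewrite sqrtrM ?sqr_ge0// sqrtr_sqr.
Qed.

(** The bound [<= 1] instead of equality covers [w = 0], even in dimension 0. *)
Lemma inorm_direction w : exists2 u, inorm dot u <= 1 & w = inorm dot w *: u.
Proof.
have [w0|w0] := eqVneq (inorm dot w) 0.
  by exists 0; rewrite ?inorm0// scaler0 (inorm0_eq0 w0).
exists ((inorm dot w)^-1 *: w); last by rewrite scalerA mulfV// scale1r.
by rewrite inormZ gtr0_norm ?invr_gt0 ?lt_def ?w0 ?inorm_ge0// mulVf.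
Qed.

Lemma is_derive_inormX p w v : (2 <= p)%N ->
  is_derive (0 : R) (1 : R) (fun s => inorm dot (w + s *: v) ^+ p)
    (p%:R * inorm dot w ^+ p.-2 * dot w v).
Proof.
case: p => [|[|p]]// _.
have [w0|w0] := eqVneq w 0.
  rewrite w0 linear0l mulr0.
  (* The norm need not be differentiable at 0, but here its power is a constant times [s^2 |s|^p],
     whose difference quotient [h |h|^p] tends to 0. *)
  have -> : (fun s => inorm dot (0 + s *: v) ^+ p.+2) =
     (fun s : R => s ^+ 2 * `|s| ^+ p) * cst (inorm dot v ^+ p.+2).
    apply/funext => s; rewrite !fctE add0r inormZ exprMn; congr (_ * _).
    by rewrite -[p.+2]add2n exprD -normrX ger0_norm ?sqr_ge0.
  suff D : is_derive (0 : R) (1 : R) (fun s : R => s ^+ 2 * `|s| ^+ p) 0.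
    by apply: is_derive_eq; rewrite !scaler0 addr0.
  have c : (fun h : R => h^-1 *: ((h *: (1:R) + 0) ^+ 2 * `|h *: (1:R) + 0| ^+ p -
      0 ^+ 2 * `|0 : R| ^+ p)) @ (0 : R)^' --> (0 : R).
    apply/cvgrPdist_lt => e e0; exists (Num.min e 1) => /=.
      by rewrite lt_min e0 ltr01.
    move=> h /=; rewrite sub0r normrN lt_min => /andP[he h1] h0.
    rewrite [h *: 1]mulr1 addr0 expr0n mul0r subr0 scaleRE sub0r normrN.
    rewrite expr2 -mulrA mulKf// normrM normrX normr_id (le_lt_trans _ he)//.
    by rewrite ler_piMr// exprn_ile1// ltW.
  apply: DeriveDef; first by apply/cvg_ex; exists 0.
  exact: cvg_lim c.
have r0 : inorm dot w != 0 by apply: contra_neq w0; exact: inorm0_eq0.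
(* Away from 0 the norm along the line is the square root of the quadratic [Q], with [Q 0 > 0], and
   the chain rule applies. *)
pose Q : R -> R := cst (dot w w) + @id R * cst (2 * dot w v) +
  @id R * @id R * cst (dot v v).
have -> : (fun s => inorm dot (w + s *: v) ^+ p.+2) = (Num.sqrt \o Q) ^+ p.+2.
  apply/funext => s; rewrite fctE /= /inorm; congr (Num.sqrt _ ^+ _).
  rewrite (addrC w) dotPl !dotPr (dotC v w) /Q !fctE; ring.
have Q0 : Q 0 = dot w w by rewrite /Q !fctE !mul0r !addr0.
have DQ : is_derive (0 : R) (1 : R) Q (2 * dot w v).
  have Did : is_derive (0 : R) (1 : R) (@id R) 1 := is_derive_id _ _.
  have Dc (c : R) : is_derive (0 : R) (1 : R) (cst c) 0.
    exact: is_derive_cst.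
  have D := is_deriveD (is_deriveD (Dc (dot w w)) (is_deriveM Did (Dc (2 * dot w v))))
    (is_deriveM (is_deriveM Did Did) (Dc (dot v v))).
  by apply: (is_derive_eq D); rewrite !fctE !scaleRE; ring.
have DsQ : is_derive (0 : R) (1 : R) (Num.sqrt \o Q)
    ((2 * inorm dot w)^-1 * (2 * dot w v)).
  apply: is_derive1_comp; rewrite Q0; apply: is_derive1_sqrt.
  by rewrite neq0_dnorm_gt0.
apply: is_derive_eq; rewrite scaleRE /= Q0 -/(inorm dot w) exprS.
by field.
Qed.

Lemma smooth_nabla_le L q f vs x y : smooth_of_order dot L q f ->
  size vs = q -> all (fun v => inorm dot v <= 1) vs ->
  `|nabla f vs y - nabla f vs x| <= L * inorm dot (y - x).
Proof.
move=> [_ Lf] /eqP sv /allP vs1; rewrite -lee_fin; apply: le_trans (Lf x y).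
apply: ereal_sup_ubound; exists (Tuple sv) => //= j.
by apply: vs1; exact: mem_tnth.
Qed.

(** For [v] in the unit ball this is the one-variable Taylor estimate for the derivative of [f]
    along [v], restricted to the line from [x] to [y]; homogeneity in [v] gives the general case. *)
Lemma dtaylor_remainder L q f x y v : 0 <= L -> (0 < q)%N ->
  smooth_of_order dot L q f ->
  `|nabla f [:: v] y - dtaylor f q x (y - x) v|
    <= L * inorm dot (y - x) ^+ q / q`!%:R * inorm dot v.
Proof.
move=> L0 q0 sf; have cf := sf.1.
case: q q0 sf cf => // q _ sf cf; set r := inorm dot (y - x).
have r0 : 0 <= r := inorm_ge0 _.
have unit_bound v1 : inorm dot v1 <= 1 ->
    `|nabla f [:: v1] y - dtaylor f q.+1 x (y - x) v1|
      <= L * r ^+ q.+1 / (q.+1)`!%:R.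
  move=> v11; have [u u1 Eu] := inorm_direction (y - x).
  (* [nabla] puts the latest direction first, so differentiating along the line prepends one more
     [u] and leaves [v1] last. *)
  pose phi j t := nabla f (nseq j u ++ [:: v1]) (x + t *: u).
  have dphi i t : (i < q)%N -> is_derive t (1 : R) (phi i) (phi i.+1 t).
    move=> iq; apply: is_derive_line; apply: (differentiable_nabla _ cf).
    by rewrite size_cat size_nseq addn1 ltnS ltnW.
  have phiq t : 0 <= t <= r -> `|phi q t - phi q 0| <= L * t.
    move=> /andP[t0 _]; apply: le_trans (smooth_nabla_le _ _ sf _ _) _.
    - by rewrite size_cat size_nseq addn1.
    - by rewrite all_cat all_nseq /= v11 u1 orbT.
    rewrite scale0r addr0 addrC addKr inormZ ger0_norm//.
    by rewrite ler_wpM2l// ler_piMr.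
  have := taylor_remainder_le r0 dphi phiq.
  have -> : phi 0%N r = nabla f [:: v1] y by rewrite /phi -Eu addrC subrK.
  rewrite (_ : \sum_(_ < _) _ = dtaylor f q.+1 x (y - x) v1)//.
  apply: eq_bigr => i _; rewrite -mulrA; congr (_ * _).
  have le1 : (size (nseq i (r *: u)) + size ([::] : seq V) < q.+2)%N.
    by rewrite size_nseq addn0 ltnW// ltnS.
  have le2 : (i + size [:: v1] <= q.+2)%N by rewrite addn1 ltnW// ltnS.
  have mv := nabla_move v1 cf le1; rewrite cats0 in mv.
  rewrite /phi scale0r addr0 Eu -/r -mv (nabla_nseqZ _ _ _ cf le2).
  exact: mulrC.
have [v1 v1n Ev] := inorm_direction v.
rewrite [X in nabla f [:: X] y]Ev [X in dtaylor _ _ _ _ X]Ev.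
have -> : nabla f [:: inorm dot v *: v1] y -
    dtaylor f q.+1 x (y - x) (inorm dot v *: v1) =
    inorm dot v * (nabla f [:: v1] y - dtaylor f q.+1 x (y - x) v1).
  rewrite nabla_consZ mulrBr mulr_sumr; congr (_ - _).
  by apply: eq_bigr => i _; rewrite nabla_consZ mulrCA.
rewrite normrM ger0_norm ?inorm_ge0// [inorm dot v * _]mulrC.
by rewrite ler_wpM2r ?inorm_ge0// unit_bound.
Qed.

End InnerNorm.

(** * Rising factorials and scalar inequalities *)

Section Rising.

Lemma risingS k q : rising k q.+1 = (rising k q * (k + q))%N.
Proof. by rewrite /rising big_ord_recr. Qed.

Lemma rising_recl k q : rising k q.+1 = (k * rising k.+1 q)%N.
Proof.
rewrite /rising big_ord_recl /= addn0; congr (_ * _)%N.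
by apply: eq_bigr => i _; rewrite /bump /= add1n addSnnS.
Qed.

Lemma leq_exp_rising k q : (k ^ q <= rising k q)%N.
Proof.
rewrite /rising -[q in (k ^ q)%N]card_ord -prod_nat_const.
by apply: leq_prod => i _; exact: leq_addr.
Qed.

Lemma rising_le_exp k q : (rising k q <= (k + q) ^ q)%N.
Proof.
rewrite /rising -[q in (_ ^ q)%N]card_ord -prod_nat_const.
by apply: leq_prod => i _; rewrite leq_add2l ltnW.
Qed.

(** Removing the common factor [rising k q ^ q] leaves [rising_le_exp]. This supplies the hypothesis
    [a^p <= b^(p-1)] of [scalar_bound]. *)
Lemma rising_expS_le k q : (rising k q ^ q.+1 <= rising k q.+1 ^ q)%N.
Proof.
rewrite risingS expnMn expnS mulnC leq_mul2l rising_le_exp orbT//.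
Qed.

End Rising.

Section Scalar.
Context {R : realType}.

(** Young's inequality for integer exponents: multiply the induction hypothesis by [s] and add the
    nonnegative term [(q+1) u^q (s-u)^2]. *)
Lemma young_exp q (u s : R) : 0 <= u -> 0 <= s ->
  q.+1%:R * u ^+ q * s <= s ^+ q.+1 + q%:R * u ^+ q.+1.
Proof.
move=> u0 s0; elim: q => [|q IH]; first by rewrite !expr0 mul0r addr0 !mul1r expr1.
have sq : 0 <= q.+1%:R * u ^+ q * (s - u) ^+ 2.
  by rewrite mulr_ge0 ?sqr_ge0// mulr_ge0 ?exprn_ge0// ler0n.
have := ler_wpM2r s0 IH.
rewrite mulrDl -exprSr; move: sq.
rewrite -(natr1 q.+1) -(natr1 q) [s ^+ q.+2]exprSr !(exprSr u).
move: (s ^+ q.+1) (u ^+ q) (q%:R : R) => S U n; lra.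
Qed.

Lemma exists_root q (t : R) : 0 <= t -> exists2 u, 0 <= u & u ^+ q.+1 = t.
Proof.
move=> t0; exists (t `^ (q.+1%:R)^-1); first exact: powR_ge0.
by rewrite -powR_mulrn ?powR_ge0// -powRrM mulVf ?pnatr_eq0// powRr1.
Qed.

(* Used with [p = q + 2], [M = (N^2 - 1)^{(p-2)/2}], [m = <g, x_{k+1} - y_{k+1}>],
   [s = |z_k - z_{k+1}|] and [ga = |<g, v>|], [v] the unit vector along
   [z_k - z_{k+1}]. *)
Lemma scalar_bound q (eps N C M r ga m s a b : R) :
  0 < eps -> 1 < N -> 0 < C -> 0 <= M -> M ^+ 2 = (N ^+ 2 - 1) ^+ q ->
  C * ((2 * N) ^+ q.+1 * q.+2%:R ^+ q.+2) <= M ->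
  0 <= r -> 0 <= ga -> 0 <= s -> 0 <= a -> 0 <= b -> a ^+ q.+2 <= b ^+ q.+1 ->
  (r = 0 -> m = 0) ->
  ga ^+ 2 + (N / eps * r ^+ q) ^+ 2 * r ^+ 2 - (r ^+ q.+1 / eps) ^+ 2
     <= 2 * (N / eps * r ^+ q) * m ->
  C * q.+2%:R * a * ga * s <= s ^+ q.+2 / (eps * q.+2%:R) + C * b * m.
Proof.
move=> e0 N1 C0 M0 M2 CM r0 ga0 s0 a0 b0 ab rm H.
have p0 : 0 < q.+2%:R :> R by rewrite ltr0n.
have lhs0 : 0 <= s ^+ q.+2 / (eps * q.+2%:R).
  by rewrite divr_ge0 ?exprn_ge0// mulr_ge0// ltW.
(* If the proximal step does not move, the hypothesis forces [ga = 0], and the left side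
   vanishes. *)
have [r_eq0|rn0] := eqVneq r 0.
  have : ga ^+ 2 <= 0.
    move: H; rewrite (rm r_eq0) r_eq0 !expr0n /= !mulr0 mul0r expr0n/=.
    by rewrite addr0 subr0.
  rewrite (rm r_eq0) mulr0 addr0 => ga20.
  have /eqP -> : ga == 0 by rewrite -sqrf_eq0 eq_le ga20 sqr_ge0.
  by rewrite mulr0 mul0r.
have rgt0 : 0 < r by rewrite lt_def rn0.
have N2 : 0 < N ^+ 2 - 1 by nra.
pose W := 2 * N * m.
(* Multiplying by [eps^2] merges the two powers of [r] into one with coefficient [N^2 - 1], positive
   because [N > 1]. P1 and P2 below each drop one of the two nonnegative terms on the left. *)
have H2 : (eps * ga) ^+ 2 + (N ^+ 2 - 1) * (r ^+ q.+1) ^+ 2 <= eps * r ^+ q * W.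
  have := ler_wpM2l (sqr_ge0 eps) H.
  rewrite (exprSr r q) /W.
  set l := (X in X <= _ -> _); set l' := (X in _ -> X <= _).
  have -> : l = l' by rewrite /l /l'; field; rewrite gt_eqF.
  set t := (X in _ <= X -> _); set t' := (X in _ -> _ <= X).
  by have -> : t = t' by rewrite /t /t'; field; rewrite gt_eqF.
have W0 : 0 <= W.
  have er : 0 < eps * r ^+ q by rewrite mulr_gt0// exprn_gt0.
  rewrite -(pmulr_rge0 _ er); apply: le_trans H2.
  by rewrite addr_ge0 ?sqr_ge0// mulr_ge0 ?sqr_ge0// ltW.
have m0 : 0 <= m by move: W0; rewrite /W pmulr_rge0//; nra.
have P1 : eps * ga ^+ 2 <= r ^+ q * W.
  rewrite -(ler_pM2l e0) [leLHS]mulrA [leRHS]mulrA.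
  apply: le_trans H2; rewrite -expr2 exprMn lerDl mulr_ge0 ?sqr_ge0//.
  exact: ltW.
have P2 : (N ^+ 2 - 1) * r ^+ q.+2 <= eps * W.
  have rq : 0 < r ^+ q by rewrite exprn_gt0.
  rewrite -(ler_pM2l rq); apply: le_trans (_ : eps * r ^+ q * W <= _); last first.
    by rewrite [leRHS]mulrCA [leRHS]mulrA.
  apply: le_trans H2; rewrite mulrCA -exprD exprAC -exprM.
  rewrite (_ : (q + q.+2 = 2 * q.+1)%N); last by rewrite mul2n -addnn addnS addSn.
  by rewrite exprM exprAC lerDr sqr_ge0.
(* Eliminate [r] by multiplying P1 to the power p with P2 to the power p - 2. *)
have WM : eps * ga ^+ q.+2 * M <= W ^+ q.+1.
  have K0 : 0 < (r ^+ q) ^+ q.+2 * eps ^+ q by rewrite mulr_gt0// !exprn_gt0.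
  have x0 : 0 <= eps * ga ^+ q.+2 * M.
    by apply: mulr_ge0 M0; apply: mulr_ge0 (ltW e0) _; exact: exprn_ge0.
  have y0 : 0 <= W ^+ q.+1 by exact: exprn_ge0.
  (* Both sides are squared because [M] is known only through [M^2]; the power of [r] then cancels
     from the product. *)
  rewrite -ler_sqr//.
  rewrite -(ler_pM2l K0).
  have l1 : 0 <= eps * ga ^+ 2 := mulr_ge0 (ltW e0) (sqr_ge0 ga).
  have l2 : 0 <= (N ^+ 2 - 1) * r ^+ q.+2 := mulr_ge0 (ltW N2) (exprn_ge0 q.+2 r0).
  have := ler_pM (exprn_ge0 q.+2 l1) (exprn_ge0 q l2)
    (lerXn2r q.+2 l1 (le_trans l1 P1) P1) (lerXn2r q l2 (le_trans l2 P2) P2).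
  have x2 (x : R) : x ^+ q.+2 = x ^+ q * x ^+ 2 by rewrite -exprD addn2.
  rewrite (exprMn q.+2 eps) (exprAC ga) (x2 eps) (exprMn q (N ^+ 2 - 1)) -M2.
  rewrite (exprAC r q.+2) (exprMn q.+2 _ W) (x2 W) (exprMn q eps) (exprSr W q).
  move: (_ ^+ q.+2) (ga ^+ q.+2) => X Y.
  set l := (X in X <= _ -> _); set l' := (X in _ -> X <= _).
  have -> : l = l' by rewrite /l /l'; ring.
  set t := (X in _ <= X -> _); set t' := (X in _ -> _ <= X).
  by have -> : t = t' by rewrite /t /t'; ring.
have e' : 0 <= eps * (C * q.+2%:R * a * ga) by rewrite !mulr_ge0// ltW.
(* [u^(p-1)] is chosen so that the left side of Young's inequality is [eps p] times the left side of
   the goal. *)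
have [u u0 Eu] := exists_root q e'.
have uE : u ^+ q.+2 <= eps * (C * b * m).
  rewrite -(ler_pXn2r (ltn0Sn q)) ?nnegrE ?exprn_ge0//; last first.
    by rewrite !mulr_ge0// ltW.
  rewrite exprAC Eu.
  have eq0 : 0 <= eps ^+ q.+1 by rewrite exprn_ge0 ?(ltW e0).
  have Cq0 : 0 <= C ^+ q.+1 by rewrite exprn_ge0 ?(ltW C0).
  have ap0 : 0 <= a ^+ q.+2 by rewrite exprn_ge0.
  have gp0 : 0 <= ga ^+ q.+2 by rewrite exprn_ge0.
  have NN : 0 < (2 * N) ^+ q.+1 by rewrite exprn_gt0// mulr_gt0//; lra.
  rewrite -(ler_pM2l NN).
  (* The bound on [C] enters here: one factor [C (2N)^(p-1) p^p] is replaced by [M]. Afterwards [ab]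
     and [WM] finish the comparison. *)
  apply: (@le_trans _ _
      (M * (eps ^+ q.+1 * C ^+ q.+1 * a ^+ q.+2 * (eps * ga ^+ q.+2)))).
    have K0 : 0 <= eps ^+ q.+1 * C ^+ q.+1 * a ^+ q.+2 * (eps * ga ^+ q.+2).
      exact: mulr_ge0 (mulr_ge0 (mulr_ge0 eq0 Cq0) ap0) (mulr_ge0 (ltW e0) gp0).
    apply: le_trans (ler_wpM2r K0 CM).
    rewrite le_eqVlt; apply/orP; left; apply/eqP.
    rewrite (exprMn q.+2 eps) (exprMn q.+2 _ ga) (exprMn q.+2 _ a) (exprMn q.+2 C).
    rewrite (exprS eps q.+1) (exprS C q.+1).
    ring.
  apply: (@le_trans _ _ (eps ^+ q.+1 * C ^+ q.+1 * (b ^+ q.+1 * W ^+ q.+1))).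
    rewrite (_ : M * _ = eps ^+ q.+1 * C ^+ q.+1 * (a ^+ q.+2 * (eps * ga ^+ q.+2 * M))); last ring.
    apply: ler_wpM2l; first exact: mulr_ge0.
    by apply: ler_pM => //; exact: mulr_ge0 (mulr_ge0 (ltW e0) gp0) M0.
  rewrite le_eqVlt; apply/orP; left; apply/eqP.
  rewrite /W (exprMn q.+1 (2 * N) m) (exprMn q.+1 eps) (exprMn q.+1 _ m).
  by rewrite (exprMn q.+1 C b); ring.
have Y := young_exp q.+1 u0 s0; rewrite {}Eu in Y.
have ep : 0 < eps * q.+2%:R by rewrite mulr_gt0.
rewrite -(ler_pM2l ep) [leRHS]mulrDr.
rewrite (_ : eps * q.+2%:R * (s ^+ q.+2 / _) = s ^+ q.+2); last first.
  by rewrite mulrC divfK// gt_eqF.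
rewrite (_ : _ * (_ * s) = q.+2%:R * (eps * (C * q.+2%:R * a * ga)) * s); last ring.
apply: le_trans Y _; rewrite lerD2l.
rewrite (_ : _ * (_ * m) = q.+2%:R * (eps * (C * b * m))); last ring.
by rewrite ler_pM ?exprn_ge0// ler_nat.
Qed.

End Scalar.

(** * Optimality conditions *)

Section Descent.
Local Open Scope classical_set_scope.
Context {R : realType} {d : nat}.
Local Notation V := 'rV[R]_d.
Variable dot : {dot V for idfun}.
Implicit Types (f h : V -> R) (u v w x y z : V).

Lemma nabla1B f x u v : nabla f [:: u - v] x = nabla f [:: u] x - nabla f [:: v] x.
Proof. by rewrite /= linearB. Qed.

(** On [0, 1] the chord minus [f] is nonnegative and it vanishes at 0, so its derivative at 0 is
    nonnegative. *)
Lemma convex_gradient f x y : convex f -> differentiable f x ->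
  nabla f [:: y - x] x <= f y - f x.
Proof.
move=> cf df; pose g s := f (x + s *: (y - x)).
have Dg : is_derive (0 : R) (1 : R) g (nabla f [:: y - x] x).
  have := @is_derive_line R d f x (y - x) 0.
  by rewrite scale0r addr0; apply.
have Dk : is_derive (0 : R) (1 : R)
    (cst (f x) + @id R * cst (f y - f x) - g) (f y - f x - nabla f [:: y - x] x).
  have Did : is_derive (0 : R) (1 : R) (@id R) 1 := is_derive_id _ _.
  have Dc (c : R) : is_derive (0 : R) (1 : R) (cst c) 0.
    exact: is_derive_cst.
  have D := is_deriveB (is_deriveD (Dc (f x)) (is_deriveM Did (Dc (f y - f x)))) Dg.
  by apply: (is_derive_eq D); rewrite !scaleRE mulr0 !add0r mulr1.
rewrite -subr_ge0; apply: (is_derive_ge0 Dk) => e e0.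
pose s := Num.min e 1 / 2.
have s0 : 0 < s by rewrite divr_gt0// lt_min e0 ltr01.
have s1 : s <= 1 by rewrite /s ler_pdivrMr// mul1r ge_min ler1n orbT.
have se : s < e.
  rewrite /s ltr_pdivrMr//; apply: (@le_lt_trans _ _ e); first by rewrite ge_min lexx.
  by rewrite ltr_pMr// ltr1n.
exists s; first by rewrite s0.
have cv : f (s *: y + (1 - s) *: x) <= s * f y + (1 - s) * f x.
  by have := cf (Itv01 (ltW s0) s1) y x; rewrite !inE; exact.
have E : s *: y + (1 - s) *: x = x + s *: (y - x).
  by rewrite scalerBl scale1r scalerBr addrCA.
rewrite {}E in cv; rewrite /g !fctE scale0r mul0r !addr0 add0r; lra.
Qed.

(* If [G] represents [g], then [|G + ka w| <= rho] and it suffices to expand the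
   square; testing the hypothesis on [u] below avoids the representation. *)
Lemma plane_bound (g : V -> R) (ka rho : R) w v :
  (forall (a : R) u1 u2, g (a *: u1 + u2) = a * g u1 + g u2) ->
  (forall u, `|g u + ka * dot w u| <= rho * inorm dot u) ->
  inorm dot v <= 1 ->
  `|g v| ^+ 2 + ka ^+ 2 * inorm dot w ^+ 2 - rho ^+ 2 <= 2 * ka * - g w.
Proof.
move=> gl H v1; have g0 : g 0 = 0.
  by have := gl (-1) 0 0; rewrite scaler0 addr0 mulN1r addNr.
have gZ a1 u1 : g (a1 *: u1) = a1 * g u1 by have := gl a1 u1 0; rewrite g0 !addr0.
have dotZr a1 u1 u2 : dot u2 (a1 *: u1) = a1 * dot u2 u1 by rewrite linearZr_LR.
have dotZl a1 u1 u2 : dot (a1 *: u1) u2 = a1 * dot u1 u2 by rewrite linearZl_LR.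
pose u := g v *: v + ka *: w.
have := le_trans (ler_norm _) (H u).
rewrite /u gl gZ dotPr dotZr.
set U := inorm dot _ => H1.
have EU : U ^+ 2 = g v ^+ 2 * inorm dot v ^+ 2 + 2 * g v * ka * dot w v
    + ka ^+ 2 * inorm dot w ^+ 2.
  by rewrite /U !inorm_sqr dotPl !dotPr !dotZl !dotZr (dotC dot v w); ring.
rewrite real_normK ?num_real// -[dot w w]inorm_sqr in H1 *.
have v2 : g v ^+ 2 * inorm dot v ^+ 2 <= g v ^+ 2.
  by rewrite ler_piMr ?sqr_ge0// exprn_ile1 ?inorm_ge0.
(* This is [2 rho U <= rho^2 + U^2]. With [H1] and [EU], the mixed terms in [dot w v] cancel. *)
have := sqr_ge0 (rho - U).
move: (inorm dot w) (dot w v) EU H1 v2 => n t; nra.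
Qed.

Lemma prox_taylor_gradient p q f (eps N : R) x y v : (2 <= p)%N ->
  Cn q f ->
  is_argmin (fun w => taylor f q x w + N / (eps * p%:R) * inorm dot (w - x) ^+ p) y ->
  dtaylor f q x (y - x) v +
    N / eps * inorm dot (y - x) ^+ p.-2 * dot (y - x) v = 0.
Proof.
move=> p2 cf ym.
have D1 := @is_derive_taylor _ _ q f q x y v cf (leqnn q).
have D2 := @is_derive_inormX _ _ dot p (y - x) v p2.
have D := is_deriveD D1 (is_deriveZ (N / (eps * p%:R)) D2).
have := is_derive_min D; rewrite !fctE /= => E.
transitivity (dtaylor f q x (y - x) v +
  N / (eps * p%:R) *: (p%:R * inorm dot (y - x) ^+ p.-2 * dot (y - x) v)).
  congr (_ + _); rewrite scaleRE !mulrA; congr (_ * _ * _).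
  by rewrite invfM mulrA divfK// pnatr_eq0 -lt0n ltnW.
apply: E => s; rewrite scale0r !addr0 !scaleRE.
by have := ym (y + s *: v); rewrite (addrAC y).
Qed.

Lemma mirror_gradient f h (A eps : R) y z z' v :
  (forall x, differentiable h x) ->
  is_argmin (fun w => A * nabla f [:: w] y + eps^-1 * bregman h w z) z' ->
  A * nabla f [:: v] y + eps^-1 * (nabla h [:: v] z' - nabla h [:: v] z) = 0.
Proof.
move=> dh zm.
pose B s := bregman h (z' + s *: v) z.
have DB : is_derive (0 : R) (1 : R) B (nabla h [:: v] z' - nabla h [:: v] z).
  have D1 := @is_derive_line R d h z' v 0.
  rewrite scale0r addr0 in D1; have {}D1 := D1 (dh z').
  have Did : is_derive (0 : R) (1 : R) (@id R) 1 := is_derive_id _ _.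
  have Dc (c : R) : is_derive (0 : R) (1 : R) (cst c) 0.
    exact: is_derive_cst.
  have D := is_deriveB (is_deriveB D1 (Dc (h z)))
    (is_deriveD (is_deriveM Did (Dc (nabla h [:: v] z))) (Dc (nabla h [:: z' - z] z))).
  have -> : B = (fun s => h (z' + s *: v)) - cst (h z) -
      (@id R * cst (nabla h [:: v] z) + cst (nabla h [:: z' - z] z)).
    apply/funext => s; rewrite !fctE /B /bregman.
    have -> : z' + s *: v - z = s *: v + (z' - z) by rewrite addrAC addrC.
    by rewrite nabla_cons_linear.
  apply: (is_derive_eq D).
  rewrite -[X in X - 0 - _ = _]/(nabla h [:: v] z').
  move: (nabla h [:: v] z') (nabla h [:: v] z) => t1 t2.
  by rewrite !scaleRE mulr0 !add0r mulr1 addr0 subr0.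
pose L s := A * nabla f [:: z' + s *: v] y.
have DL : is_derive (0 : R) (1 : R) L (A * nabla f [:: v] y).
  have Did : is_derive (0 : R) (1 : R) (@id R) 1 := is_derive_id _ _.
  have Dc (c : R) : is_derive (0 : R) (1 : R) (cst c) 0.
    exact: is_derive_cst.
  have D := is_deriveD (Dc (A * nabla f [:: z'] y))
    (is_deriveM Did (Dc (A * nabla f [:: v] y))).
  have -> : L = cst (A * nabla f [:: z'] y) + @id R * cst (A * nabla f [:: v] y).
    apply/funext => s; rewrite !fctE /L.
    by rewrite (addrC z') nabla_cons_linear; ring.
  by apply: (is_derive_eq D); rewrite !scaleRE mulr0 !add0r mulr1.
have := is_derive_min (is_deriveD DL (is_deriveZ eps^-1 DB)); apply => s.
rewrite -[leLHS]/(L 0 + eps^-1 * B 0) -[leRHS]/(L s + eps^-1 * B s) /L /B.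
by rewrite scale0r addr0; exact: zm.
Qed.

End Descent.

(** * The Lyapunov function *)

Section Lyapunov.
Context {R : realType} {d : nat}.
Local Notation V := 'rV[R]_d.
Variable dot : {dot V for idfun}.
Implicit Types (f h : V -> R).

(** Applied with [u] the minimizer, [v] the new mirror point and [w] the old one; [mirror_gradient]
    turns the gradient difference into a multiple of the pairing of the gradient of [f] with
    [u - v]. *)
Lemma bregman_three_points h (u v w : V) :
  bregman h u v - bregman h u w =
  - bregman h v w + (nabla h [:: u - v] w - nabla h [:: u - v] v).
Proof.
rewrite /bregman !nabla1B.
move: (nabla h [:: u] v) (nabla h [:: u] w) (nabla h [:: v] v) (nabla h [:: v] w).
by move: (nabla h [:: w] w) => t1 t2 t3 t4 t5; ring.
Qed.

Lemma lyapunov_step q k (eps N C M : R) f h (xs y z x' y' z' : V) :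
  0 < eps -> 1 < N -> 0 < C -> 0 <= M -> M ^+ 2 = (N ^+ 2 - 1) ^+ q ->
  C * ((2 * N) ^+ q.+1 * q.+2%:R ^+ q.+2) <= M ->
  convex f -> smooth_of_order dot (q.+1`!%:R / eps) q.+1 f ->
  (forall x, differentiable h x) -> uniformly_convex dot 1 q.+2 h ->
  x' = (q.+2%:R / (k + q.+2)%:R) *: z + (k%:R / (k + q.+2)%:R) *: y ->
  is_argmin (fun w => taylor f q.+1 x' w +
                      N / (eps * q.+2%:R) * inorm dot (w - x') ^+ q.+2) y' ->
  is_argmin (fun w => C * q.+2%:R * (rising k.+1 q.+1)%:R * nabla f [:: w] y' +
                      eps^-1 * bregman h w z) z' ->
  C * (rising k.+1 q.+2)%:R * (f y' - f xs) + eps^-1 * bregman h xs z' <=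
  C * (rising k q.+2)%:R * (f y - f xs) + eps^-1 * bregman h xs z.
Proof.
move=> e0 N1 C0 M0 M2 CM cvx sf dh uc Ex ym zm.
have df u : differentiable f u := sf.1.1 u.
pose g u := nabla f [:: u] y'.
have gl (a : R) u1 u2 : g (a *: u1 + u2) = a * g u1 + g u2.
  exact: nabla_cons_linear.
have gB u1 u2 : g (u1 - u2) = g u1 - g u2 by exact: nabla1B.
pose r := inorm dot (y' - x').
(* Stationarity of the proximal step replaces [dtaylor] by the gradient of the norm power, and the
   smoothness constant [(p-1)! / eps] cancels the factorial in the remainder. *)
have gradient_bound u : `|g u + N / eps * r ^+ q * dot (y' - x') u|
    <= r ^+ q.+1 / eps * inorm dot u.
  have E := prox_taylor_gradient u (isT : (2 <= q.+2)%N) (Cn_le (leqnSn _) sf.1) ym.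
  have L0 : 0 <= q.+1`!%:R / eps by rewrite divr_ge0// ltW.
  have := dtaylor_remainder x' y' u L0 (ltn0Sn q) sf.
  rewrite -/(g u) -/r.
  have -> : dtaylor f q.+1 x' (y' - x') u = - (N / eps * r ^+ q * dot (y' - x') u).
    by apply/eqP; rewrite -addr_eq0 -/r; apply/eqP.
  rewrite opprK; congr (_ <= _ * _).
  by field; rewrite gt_eqF//= pnatr_eq0 -lt0n fact_gt0.
have [v v1 Ev] := inorm_direction dot (z - z').
set s := inorm dot (z - z') in Ev.
pose a : R := (rising k.+1 q.+1)%:R; pose b : R := (rising k.+1 q.+2)%:R.
have a0 : 0 <= a by exact: ler0n.
have b0 : 0 <= b by exact: ler0n.
have s0 : 0 <= s by exact: inorm_ge0.
have r0 : 0 <= r by exact: inorm_ge0.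
have ab : a ^+ q.+2 <= b ^+ q.+1 by rewrite -!natrX ler_nat rising_expS_le.
have rm : r = 0 -> - g (y' - x') = 0.
  by move=> /inorm0_eq0 ->; rewrite -(subrr 0) gB subrr oppr0.
have S := scalar_bound e0 N1 C0 M0 M2 CM r0 (normr_ge0 (g v)) s0 a0 b0 ab rm
  (plane_bound gl gradient_bound v1).
have gzz : g z - g z' <= `|g v| * s.
  rewrite -gB Ev -[s *: v]addr0 gl -(subrr 0) gB subrr addr0 mulrC.
  by rewrite ler_wpM2r// ler_norm.
have U : s ^+ q.+2 / (eps * q.+2%:R) <= eps^-1 * bregman h z' z.
  have -> : s ^+ q.+2 / (eps * q.+2%:R) = eps^-1 * (1 / q.+2%:R * s ^+ q.+2).
    by rewrite invfM mulrCA mulrC mul1r; ring.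
  rewrite ler_wpM2l ?invr_ge0 ?(ltW e0)//.
  have <- : inorm dot (z' - z) = s.
    by rewrite -(opprB z z') -scaleN1r inormZ normrN1 mul1r.
  exact: uc.
have F1 := convex_gradient xs cvx (df y').
have F2 := convex_gradient y cvx (df y').
rewrite nabla1B -/(g _) -/(g _) in F1; rewrite nabla1B -/(g _) -/(g _) in F2.
have O := mirror_gradient (xs - z') dh zm.
rewrite -/(g _) gB -/a in O.
have T := bregman_three_points h xs z' z.
have kp : (k + q.+2)%:R != 0 :> R by rewrite pnatr_eq0 addnS.
have X : (k + q.+2)%:R * g x' = q.+2%:R * g z + k%:R * g y.
  have gZ c u : g (c *: u) = c * g u by exact: nabla_consZ.
  by rewrite Ex gl gZ; field.
(* Since [b = a (k+p)] and [rising k p = k a], the function-value part of the energy changes by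
   [C a (p (f y' - f xs) + k (f y' - f y))]. Convexity at [y'] bounds both differences, and [X]
   trades [y] for [z] and [x']. *)
have Eb : b = a * (k + q.+2)%:R.
  by rewrite /b risingS natrM addSn -addnS.
have EB : (rising k q.+2)%:R = k%:R * a by rewrite rising_recl natrM.
rewrite EB -/b Eb; rewrite Eb gB in S.
(* Each inequality is scaled by its weight, so that the conclusion is linear in the resulting
   products. *)
have {}F1 := ler_wpM2l (mulr_ge0 (mulr_ge0 (ltW C0) (ler0n _ q.+2)) a0) F1.
have {}F2 := ler_wpM2l (mulr_ge0 (mulr_ge0 (ltW C0) (ler0n _ k)) a0) F2.
have {}gzz := ler_wpM2l (mulr_ge0 (mulr_ge0 (ltW C0) (ler0n _ q.+2)) a0) gzz.
have {}X : C * (a * (k + q.+2)%:R) * g x' =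
  C * a * (q.+2%:R * g z + k%:R * g y) by rewrite -X; ring.
move: S F1 F2 gzz U O X T; rewrite natrD -!/(g _).
move: (bregman h xs z') (bregman h xs z) (bregman h z' z).
move: (nabla h [:: xs - z'] z) (nabla h [:: xs - z'] z').
move: (g z) (g z') (g xs) (g y) (g y') (g x') (f xs) (f y) (f y').
move: (_ / (eps * _)) eps^-1 (`|g v| : R) => S0 ie gv.
move: (q.+2%:R : R) (k%:R : R) => p' k'.
clearbody a s; clear -a s C p' k'.
move=> g1 g2 g3 g4 g5 g6 f1 f2 f3 n1 n2 D1 D2 D3.
by move=> S F1  F2 gzz U O X /(congr1 ( *%R ie)) T; lra.
Qed.

End Lyapunov.

(** * From the decreasing Lyapunov function to the rate in [k] *)

Theorem corollary3p5 (R : realType) :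
  exists K : nat -> R -> R -> R,
  forall (p : nat) (eps N C : R),
    (2 <= p)%N -> 0 < eps -> 1 < N -> 0 < C ->
    C <= (N ^+ 2 - 1) `^ ((p%:R - 2) / 2) / ((2 * N) ^+ p.-1 * p%:R ^+ p) ->
  forall (d : nat) (dot : {dot 'rV[R]_d for idfun})
    (f h : 'rV[R]_d -> R) (xstar : 'rV[R]_d) (x y z : nat -> 'rV[R]_d),
    convex f ->
    is_argmin f xstar -> (forall w, is_argmin f w -> w = xstar) ->
    smooth_of_order dot (p.-1`!%:R / eps) p.-1 f ->
    distance_generating dot h ->
    uniformly_convex dot 1 p h ->
    z 0%N = x 0%N ->
    (forall k : nat, x k.+1 =
       (p%:R / (k + p)%:R) *: z k + (k%:R / (k + p)%:R) *: y k) ->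
    (forall k : nat,
       is_argmin (fun w => taylor f p.-1 (x k) w
                           + N / (eps * p%:R) * inorm dot (w - x k) ^+ p)
                 (y k)) ->
    (forall k : nat, (1 <= k)%N ->
       is_argmin (fun w => C * p%:R * (rising k p.-1)%:R
                             * nabla f [:: w] (y k)
                           + eps^-1 * bregman h w (z k.-1))
                 (z k)) ->
    0 <= K p C (bregman h xstar (x 0%N)) /\
    forall k : nat, (1 <= k)%N ->
      f (y k) - f xstar <=
        K p C (bregman h xstar (x 0%N)) / (eps * k%:R ^+ p).
Proof.
(* The Lyapunov bound yields the constant [D / C]; the maximum with 0 makes nonnegativity
   immediate. *)
exists (fun _ C D => Num.max 0 D / C).
move=> [|[|q]]// eps N C _ e0 N1 C0 HC d dot f h xs x y z.
move=> cvx xsm _ sf dg uc z0 xE ym zm.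
have N2 : 0 < N ^+ 2 - 1 by nra.
set M := (_ `^ _) in HC.
have M0 : 0 <= M by exact: powR_ge0.
(* Squaring turns the possibly half-integer exponent [(p-2)/2] of the real power into the natural
   number [q]. *)
have M2 : M ^+ 2 = (N ^+ 2 - 1) ^+ q.
  rewrite -powR_mulrn ?powR_ge0// -powRrM divfK ?pnatr_eq0//.
  by rewrite -(natrB _ (isT : (2 <= q.+2)%N)) subn2 /= powR_mulrn// ltW.
have CM : C * ((2 * N) ^+ q.+1 * q.+2%:R ^+ q.+2) <= M.
  rewrite -ler_pdivlMr//; apply: mulr_gt0; apply: exprn_gt0; last by rewrite ltr0n.
  lra.
have dh u : differentiable h u := dg.2.1.1 u.
pose E k := C * (rising k q.+2)%:R * (f (y k) - f xs) + eps^-1 * bregman h xs (z k).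
have EK k : E k <= eps^-1 * bregman h xs (x 0%N).
  elim: k => [|k IH].
    (* The rising factorial of 0 vanishes, so [f (y 0)] does not enter the initial energy. *)
    by rewrite /E rising_recl mul0n mulr0 mul0r add0r z0.
  apply: le_trans IH; rewrite /E.
  have S := lyapunov_step xs e0 N1 C0 M0 M2 CM cvx sf dh uc (xE k)
    (ym k.+1) (zm k.+1 isT).
  exact: S.
split=> [|k k1]; first by rewrite divr_ge0 ?(ltW C0)// le_max lexx.
have k0 : 0 < k%:R ^+ q.+2 :> R by rewrite exprn_gt0// ltr0n.
have D0 : 0 <= bregman h xs (z k).
  by apply: le_trans (uc (z k) xs); rewrite mulr_ge0 ?divr_ge0 ?exprn_ge0 ?inorm_ge0.
have f0 : 0 <= f (y k) - f xs by rewrite subr_ge0.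
rewrite -[leRHS]/(Num.max 0 (bregman h xs (x 0%N)) / C / (eps * k%:R ^+ q.+2)).
rewrite (ler_pdivlMr _ _ (mulr_gt0 e0 k0)) ler_pdivlMr//.
have Dmax : bregman h xs (x 0%N) <= Num.max 0 (bregman h xs (x 0%N)).
  by rewrite le_max lexx orbT.
apply: le_trans Dmax; rewrite -(ler_pM2l (_ : 0 < eps^-1)) ?invr_gt0//.
apply: le_trans (EK k); rewrite /E.
have rk : k%:R ^+ q.+2 <= (rising k q.+2)%:R :> R.
  by rewrite -natrX ler_nat leq_exp_rising.
apply: (@le_trans _ _ (C * k%:R ^+ q.+2 * (f (y k) - f xs))).
  rewrite le_eqVlt; apply/orP; left; apply/eqP.
  by move: (_ - _) (_ ^+ _) => t u; field; rewrite gt_eqF.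
apply: (@le_trans _ _ (C * (rising k q.+2)%:R * (f (y k) - f xs))).
  by rewrite ler_wpM2r// ler_wpM2l// ltW.
by rewrite lerDl mulr_ge0// invr_ge0 ltW.
Qed.
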